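(* Let $n,k\ge 1$ be integers, and for $j=1,\dots,n$ let $\alpha^{(j)}=\langle \alpha^{(j)}_1,\dots,\alpha^{(j)}_k\rangle$ be a $k$-dimensional vector with positive real entries. Let $\mathbf{X}_1,\dots,\mathbf{X}_n$ be independent $k$-variate random vectors such that $\mathbf{X}_j$ has the $\mathrm{Dirichlet}(\alpha^{(j)}_1,\dots,\alpha^{(j)}_k)$ distribution for each $j=1,\dots,n$. Let $\mathbf{W}=\langle W_1,\dots,W_n\rangle$ be a random vector which is independent of $(\mathbf{X}_1,\dots,\mathbf{X}_n)$ and has the distribution $$\mathrm{Dirichlet}\left(\sum_{i=1}^{k}\alpha_i^{(1)},\dots,\sum_{i=1}^{k}\alpha_i^{(n)}\right).$$ Then the random linear combination $\mathbf{Z}=\sum_{i=1}^n W_i\mathbf{X}_i$ has the distribution $$\mathrm{Dirichlet}\left(\sum_{j=1}^{n}\alpha_1^{(j)},\dots,\sum_{j=1}^{n}\alpha_k^{(j)}\right).$$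
   Context: For positive reals $a_1,\dots,a_m$, $\mathrm{Dirichlet}(a_1,\dots,a_m)$ denotes the Dirichlet distribution of an $m$-dimensional random vector supported on the simplex $\{x\in\mathbb{R}^m: x_i\ge 0,\ \sum_{i=1}^m x_i=1\}$, i.e. the law of $\left(G_1/\sum_l G_l,\dots,G_m/\sum_l G_l\right)$ where $G_1,\dots,G_m$ are independent and $G_i$ is gamma distributed with shape parameter $a_i$ and a common scale. For $m=1$ it is the point mass at $1$. *)

(* Defs.v *)
From HB Require Import structures.
From mathcomp Require Import all_boot all_order all_algebra.
From mathcomp Require Import all_classical all_reals all_analysis.
From mathcomp Require Import measurable_realfun ring lra.

Set Implicit Arguments.
Unset Strict Implicit.
Unset Printing Implicit Defensive.

Import Order.TTheory GRing.Theory Num.Theory.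
Import numFieldNormedType.Exports.

Local Open Scope classical_set_scope.
Local Open Scope ring_scope.

Section gamma_density.
Context {R : realType}.
Notation mu := (@lebesgue_measure R).

(* Density of the gamma law of shape a and scale 1, up to normalization. *)
Definition gamma_kernel (a x : R) : R := x `^ (a - 1) * expR (- x).

Definition gamma_fun (a : R) : R :=
  \int[mu]_(x in `]0, +oo[) gamma_kernel a x.

Definition gamma_pdf (a : R) : R -> R :=
  (fun x => gamma_kernel a x / gamma_fun a) \_ `]0, +oo[.

Lemma gamma_kernel_ge0 a x : 0 <= gamma_kernel a x.
Proof. by rewrite mulr_ge0 ?powR_ge0 ?expR_ge0. Qed.

Lemma measurable_gamma_kernel a (D : set R) : measurable_fun D (gamma_kernel a).
Proof.
apply: measurable_funTS; apply: measurable_funM; first exact: measurable_powR.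
by apply: measurableT_comp => //; exact: measurable_funN.
Qed.

Let G (a x : R) : R := - (1 + x `^ a)^-1.
Let h (a x : R) : R := (1 + x `^ a) ^- 2 * (a * x `^ (a - 1)).

Let y1_neq0 (a x : R) : 1 + x `^ a != 0 :> R.
Proof. by rewrite gt_eqF// ltr_pwDl ?powR_ge0. Qed.

Let G_is_derive (a x : R) : 0 < x -> is_derive x (1 : R) (G a) (h a x).
Proof.
move=> x0.
have xI : x \in `]0, +oo[ by rewrite in_itv/= x0.
have D : is_derive x (1 : R) ((@powR R) ^~ a) (a * x `^ (a - 1)).
  apply: DeriveDef; first exact: derivable_powR.
  by rewrite -derive1E (powR_derive1 a xI).
have D1 : is_derive x (1 : R) (fun x : R => 1 + x `^ a) (a * x `^ (a - 1)).
  by rewrite -[a * _]add0r; exact: is_deriveD.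
have D2 := is_deriveN (@is_deriveV R (fun x : R => 1 + x `^ a) x _ 1 (y1_neq0 a x) D1).
by apply: is_derive_eq D2 _; rewrite /h scaleNr opprK.
Qed.

Let continuous_powR (b x : R) : 0 < x -> {for x, continuous ((@powR R) ^~ b)}.
Proof.
move=> x0; apply/differentiable_continuous/derivable1_diffP/derivable_powR.
by rewrite in_itv/= x0.
Qed.

Let h_continuous (a x : R) : 0 < x -> {for x, continuous (h a)}.
Proof.
move=> x0; apply: cvgM.
  apply: cvgV; first by rewrite expf_neq0.
  by apply: cvgM; apply: cvgD; try exact: cvg_cst; exact: continuous_powR.
by apply: cvgM; [exact: cvg_cst|exact: continuous_powR].
Qed.

Let gamma_kernel_le_h (a : R) : 0 < a ->
  exists2 C : R, 0 <= C & forall x : R, 0 < x -> gamma_kernel a x <= C * h a x.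
Proof.
move=> a0; have [N aN] : exists N : nat, a *+ 2 <= N.+1%:R.
  exists (Num.bound (a *+ 2)).
  rewrite ltW// (lt_le_trans (archi_boundP _)) ?ler_nat// mulrn_wge0// ltW//.
pose K : R := 4 + 2 * N.+1`!%:R.
have K0 : 0 <= K by rewrite addr_ge0// mulr_ge0.
exists (K / a); first by rewrite divr_ge0// ltW.
move=> x x0; rewrite /gamma_kernel /h.
have -> : K / a * ((1 + x `^ a) ^- 2 * (a * x `^ (a - 1))) =
          x `^ (a - 1) * (K / (1 + x `^ a) ^+ 2).
  by have := y1_neq0 a x; move: (x `^ a) (x `^ (a - 1)) => y z y0; field;
     rewrite y0 gt_eqF.
rewrite ler_wpM2l ?powR_ge0// expRN.
rewrite ler_pdivlMr ?exprn_gt0 ?ltr_pwDl ?powR_ge0//.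
rewrite ler_pdivrMl ?expR_gt0//.
have y2 : (x `^ a) ^+ 2 <= 1 + x ^+ N.+1.
  rewrite -powR_mulrn ?powR_ge0// -powRrM.
  have [x1|x1] := leP x 1.
    rewrite -[leLHS]addr0 lerD ?exprn_ge0 ?(ltW x0)//.
    have := @ge0_ler_powR R (a * 2) _ x 1; rewrite powR1; apply => //.
      by rewrite mulr_ge0// ltW.
      by rewrite nnegrE ltW.
      by rewrite nnegrE.
  rewrite -[leLHS]add0r lerD// -powR_mulrn ?(ltW x0)// ler_powR ?(ltW x1)//.
  by rewrite mulr_natr.
have xN : x ^+ N.+1 <= N.+1`!%:R * expR x.
  rewrite -ler_pdivrMl ?ltr0n ?fact_gt0// mulrC.
  by apply: le_trans (expR_ge1Dxn N (ltW x0)); rewrite lerDr.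
have e1 : 1 <= expR x by rewrite -expR0 ler_expR ltW.
move: y2 xN e1; rewrite /K; move: (x `^ a) (x ^+ N.+1) (N.+1`!%:R) (expR x).
move=> y z f e ? ? ?; have : 0 <= (y - 1) ^+ 2 by exact: sqr_ge0.
nra.
Qed.

Lemma gamma_fun_lty (a : R) : 0 < a ->
  (\int[mu]_(x in `]0%R, +oo[) (gamma_kernel a x)%:E < +oo)%E.
Proof.
move=> a0; have [C C0 Ch] := gamma_kernel_le_h a0.
pose F (n : nat) : set R := `[n.+1%:R^-1, n.+1%:R]%classic.
have FU : (`]0, +oo[%classic : set R) = \bigcup_n F n.
  apply/seteqP; split=> x /=; rewrite in_itv/= andbT.
    move=> x0.
    pose n := (Num.bound x + Num.bound x^-1)%N.
    exists n => //; rewrite /F/= in_itv/=; apply/andP; split.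
      rewrite -[leRHS]invrK lef_pV2 ?posrE ?invr_gt0 ?ltr0n//.
      rewrite ltW// (lt_le_trans (archi_boundP _)) ?invr_ge0 ?(ltW x0)//.
      by rewrite ler_nat ltnW// ltnS leq_addl.
    rewrite ltW// (lt_le_trans (archi_boundP _)) ?(ltW x0)//.
    by rewrite ler_nat ltnW// ltnS leq_addr.
  move=> [n _]; rewrite /F/= in_itv/= => /andP[+ _].
  by apply: lt_le_trans; rewrite invr_gt0 ltr0n.
have nd : {homo F : n m / (n <= m)%N >-> (n <= m)%O}.
  move=> n m nm; apply/subsetPset => x; rewrite /F/= !in_itv/= => /andP[xn nx].
  apply/andP; split; last by rewrite (le_trans nx)// ler_nat.
  by rewrite (le_trans _ xn)// lef_pV2 ?posrE ?ltr0n// ler_nat.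
have mF n : measurable (F n) by exact: measurable_itv.
have Fint n : (\int[mu]_(x in F n) (gamma_kernel a x)%:E <= C%:E)%E.
  have n0 : 0 < n.+1%:R^-1 :> R by rewrite invr_gt0 ltr0n.
  have hc : {within F n, continuous (h a)}.
    apply: continuous_in_subspaceT => x; rewrite inE /F/= in_itv/= => /andP[xn _].
    by apply: h_continuous; exact: lt_le_trans xn.
  have h0 x : 0 < x -> 0 <= h a x.
    move=> x0; rewrite mulr_ge0 ?invr_ge0 ?exprn_ge0 ?addr_ge0 ?powR_ge0//.
    by rewrite mulr_ge0 ?powR_ge0 ?(ltW a0).
  have pos x : F n x -> 0 < x.
    by rewrite /F/= in_itv/= => /andP[+ _]; exact: lt_le_trans.
  have mh : measurable_fun (F n) (h a).
    by apply: subspace_continuous_measurable_fun => //; exact: measurable_itv.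
  apply: (@le_trans _ _ (\int[mu]_(x in F n) (C%:E * (h a x)%:E))%E).
    apply: ge0_le_integral => //.
    - exact: mF.
    - by move=> x _; exact: gamma_kernel_ge0.
    - by apply/measurable_EFinP; exact: measurable_gamma_kernel.
    - by apply/measurable_EFinP; apply: measurable_funM.
    - by move=> x /pos x0; rewrite -EFinM lee_fin Ch.
  rewrite ge0_integralZl_EFin//; last 3 first.
  - exact: mF.
  - by move=> x /pos; exact: h0.
  - exact/measurable_EFinP.
  have [->|nN0] := eqVneq n 0%N.
    by rewrite /F invr1 set_itv1 integral_set1 ?mule0 ?lee_fin.
  rewrite (@continuous_FTC2 _ (h a) (G a))//.
  - rewrite -EFinB -EFinM lee_fin -[leRHS]mulr1 ler_wpM2l// /G opprK addrC.
    rewrite (@le_trans _ _ (1 + n.+1%:R^-1 `^ a)^-1)//.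
      by rewrite gerBl invr_ge0 addr_ge0 ?powR_ge0.
    by rewrite invf_le1 ?lerDl ?powR_ge0// ltr_pwDl ?powR_ge0.
  - rewrite (@lt_trans _ _ 1)// ?invf_lt1 ?ltr0n// ltr1n ltnS lt0n//.
  - have dG x : 0 < x -> {for x, continuous (G a)}.
      move=> x0; apply/differentiable_continuous/derivable1_diffP.
      by have [] := G_is_derive a x0.
    split.
    + move=> x; rewrite in_itv/= => /andP[xn _].
      by have [] := G_is_derive a (lt_trans n0 xn).
    + by apply: cvg_at_right_filter; exact: dG.
    + by apply: cvg_at_left_filter; apply: dG; rewrite ltr0n.
  - move=> x; rewrite in_itv/= => /andP[xn _].
    have D := G_is_derive a (lt_trans n0 xn).
    by rewrite derive1E derive_val.
apply: (le_lt_trans _ (ltry C)).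
have cv : (\int[mu]_(x in F n) (gamma_kernel a x)%:E @[n --> \oo] -->
    \int[mu]_(x in `]0%R, +oo[) (gamma_kernel a x)%:E)%E.
  rewrite FU; apply: ge0_nondecreasing_set_cvg_integral => //.
  - by move=> n; apply/measurable_EFinP; exact: measurable_gamma_kernel.
  - by move=> n x _; exact: gamma_kernel_ge0.
rewrite -(cvg_lim _ cv)//; apply: lime_le; first by apply/cvg_ex; eexists; exact: cv.
exact: nearW.
Qed.

Lemma gamma_fun_gt0 (a : R) : 0 < a -> 0 < gamma_fun a.
Proof.
move=> a0; rewrite /gamma_fun /Rintegral fine_gt0// gamma_fun_lty// andbT.
pose c : R := 2^-1 * expR (- 2).
have c0 : 0 < c by rewrite mulr_gt0 ?invr_gt0 ?expR_gt0.
apply: (@lt_le_trans _ _ (\int[mu]_(x in `[1%R, 2%R]) c%:E)%E).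
  rewrite integral_cst//= lebesgue_measure_itv/= lte_fin ltr1n -EFinB -EFinM.
  by rewrite lte_fin mulr_gt0// subr_gt0 ltr1n.
apply: (@le_trans _ _ (\int[mu]_(x in `[1%R, 2%R]) (gamma_kernel a x)%:E)%E).
  apply: ge0_le_integral => //.
  - by move=> x _; exact: ltW.
  - by apply/measurable_EFinP; exact: measurable_gamma_kernel.
  - move=> x /=; rewrite in_itv/= => /andP[x1 x2].
    have x0 : 0 < x by exact: lt_le_trans x1.
    rewrite lee_fin ler_pM ?invr_ge0 ?expR_ge0//; last by rewrite ler_expR lerN2.
    rewrite (@le_trans _ _ (x `^ (- 1)))//.
      by rewrite powR_inv1 ?(ltW x0)// lef_pV2 ?posrE.
    by rewrite ler_powR// lerDr ltW.
apply: ge0_subset_integral => //.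
- by apply/measurable_EFinP; exact: measurable_gamma_kernel.
- by move=> x _; exact: gamma_kernel_ge0.
- move=> x /=; rewrite !in_itv/= andbT => /andP[x1 _].
  exact: lt_le_trans x1.
Qed.

Lemma gamma_pdf_ge0 a x : 0 < a -> 0 <= gamma_pdf a x.
Proof.
move=> a0; apply: restrict_ge0 => {}x _.
by rewrite divr_ge0 ?gamma_kernel_ge0// ltW// gamma_fun_gt0.
Qed.

Lemma measurable_gamma_pdf a : measurable_fun setT (gamma_pdf a).
Proof.
apply/measurable_restrict => //; rewrite ?setTI ?setIT.
by apply: measurable_funM => //; exact: measurable_gamma_kernel.
Qed.

Lemma integral_gamma_pdf a : 0 < a -> (\int[mu]_x (gamma_pdf a x)%:E = 1)%E.
Proof.
move=> a0; have g0 := gamma_fun_gt0 a0.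
rewrite [LHS](_ : _ = \int[mu]_(x in `]0%R, +oo[)
    ((gamma_fun a)^-1%:E * (gamma_kernel a x)%:E))%E; last first.
  rewrite [RHS]integral_mkcond; apply: eq_integral => x _.
  by rewrite /gamma_pdf !patchE; case: ifPn => // _; rewrite mulrC.
rewrite ge0_integralZl_EFin ?invr_ge0 ?ltW//; last 2 first.
- by move=> x _; exact: gamma_kernel_ge0.
- by apply/measurable_EFinP; exact: measurable_gamma_kernel.
rewrite -(@fineK _ (integral _ _ _)); last first.
  rewrite ge0_fin_numE ?gamma_fun_lty// integral_ge0// => x _.
  exact: gamma_kernel_ge0.
by rewrite -EFinM mulVf ?gt_eqF.
Qed.

End gamma_density.

(* The Dirac mass at 0 is a dummy value outside the parameter range, so that
   [gamma_prob a] is a probability for every [a]. *)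
Definition gamma_prob {R : realType} (a : R) (V : set R) : \bar R :=
  (if (0 < a)%R then \int[lebesgue_measure]_(x in V) (gamma_pdf a x)%:E
   else \d_(0%R : R) V)%E.

Section gamma_prob.
Context {R : realType} (a : R).

Let gamma_prob0 : gamma_prob a set0 = 0%E.
Proof. by rewrite /gamma_prob; case: ifP; rewrite ?integral_set0 ?measure0. Qed.

Let gamma_prob_ge0 V : (0 <= gamma_prob a V)%E.
Proof.
rewrite /gamma_prob; case: ifP => // a0; apply: integral_ge0 => x _.
by rewrite lee_fin gamma_pdf_ge0.
Qed.

Let gamma_prob_sigma_additive : semi_sigma_additive (gamma_prob a).
Proof.
rewrite /gamma_prob; case: (boolP (0 < a)%R) => a0; last first.
  exact: measure_semi_sigma_additive.
move=> F mF tF mUF; apply: cvg_toP.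
  apply: ereal_nondecreasing_is_cvgn => m n mn.
  apply: lee_sum_nneg_natr => // k _ _; apply: integral_ge0 => x _.
  by rewrite lee_fin gamma_pdf_ge0.
rewrite ge0_integral_bigcup//=.
- by apply/measurable_funTS/measurable_EFinP; exact: measurable_gamma_pdf.
- by move=> x _; rewrite lee_fin gamma_pdf_ge0.
Qed.

HB.instance Definition _ := isMeasure.Build _ _ _ (gamma_prob a)
  gamma_prob0 gamma_prob_ge0 gamma_prob_sigma_additive.

Let gamma_prob_setT : gamma_prob a [set: R] = 1%E.
Proof.
rewrite /gamma_prob; case: ifP => a0; last by rewrite diracE in_setT.
exact: integral_gamma_pdf.
Qed.

HB.instance Definition _ :=
  @Measure_isProbability.Build _ _ R (gamma_prob a) gamma_prob_setT.

End gamma_prob.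

Section product_probability.
Context d (T : measurableType d) (R : realType).

Definition tuple_cons n (x : T * n.-tuple T) : n.+1.-tuple T :=
  [the n.+1.-tuple T of x.1 :: x.2].

Lemma measurable_tuple_cons n : measurable_fun setT (@tuple_cons n).
Proof. exact: measurable_cons measurable_fst measurable_snd. Qed.

HB.instance Definition _ n :=
  isMeasurableFun.Build _ _ _ _ (@tuple_cons n) (@measurable_tuple_cons n).

Fixpoint prod_prob n : ('I_n -> probability T R) -> probability (n.-tuple T) R :=
  match n with
  | 0 => fun=> \d_[tuple]
  | m.+1 => fun mu =>
      distribution (mu ord0 \x prod_prob (fun i => mu (lift ord0 i)))%E
        (@tuple_cons m)
  end.

Lemma prod_prob_box n (mu : 'I_n -> probability T R) (A : 'I_n -> set T) :
  (forall i, measurable (A i)) ->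
  prod_prob mu [set t | forall i, A i (tnth t i)] = (\prod_(i < n) mu i (A i))%E.
Proof.
elim: n mu A => [|n IH] mu A mA.
  by rewrite big_ord0 /= diracE mem_set// => -[].
rewrite big_ord_recl.
rewrite -(IH (fun i => mu (lift ord0 i)) (fun i => A (lift ord0 i)))//.
pose B : set (n.-tuple T) := [set t | forall i, A (lift ord0 i) (tnth t i)].
have mB : measurable B.
  rewrite (_ : B = \bigcap_(i in [set: 'I_n])
      ((fun t => tnth t i) @^-1` A (lift ord0 i))); last first.
    by apply/seteqP; split=> t Bt i => [_|]; exact: Bt.
  apply: fin_bigcap_measurable => // i _.
  by rewrite -[X in measurable X]setTI; exact: measurable_tnth.
rewrite -/B -product_measure1E//= /distribution /pushforward; congr (_ _).
apply/seteqP; split=> -[x t] /=.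
  move=> At; split; first by have := At ord0; rewrite tnth0.
  by move=> i; have := At (lift ord0 i); rewrite tnthS.
move=> [Ax Bt] i; have [->|i0] := eqVneq i ord0; first by rewrite tnth0.
have [j ->] : exists j, i = lift ord0 j.
  by case: (unliftP ord0 i) i0 => [j ->|->]; [exists j|rewrite eqxx].
by rewrite tnthS; exact: Bt.
Qed.

End product_probability.

Lemma measurable_inv {R : realType} : measurable_fun [set: R] (@GRing.inv R).
Proof.
rewrite (_ : @GRing.inv R = fun x => x * `|x| `^ (- 2)); last first.
  apply/funext => x; have [->|x0] := eqVneq x 0; first by rewrite mul0r invr0.
  rewrite powRN (powR_mulrn 2)// real_normK ?num_real//.
  by rewrite expr2 invfM mulVKf.
apply: measurable_funM => //.
by apply: (measurableT_comp (measurable_powR (- 2))); exact: normr_measurable.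
Qed.

Section simplex_normalize.
Context {R : realType} (m : nat).

Definition simplex_normalize (t : m.-tuple R) : m.-tuple R :=
  [tuple tnth t i / \sum_(l < m) tnth t l | i < m].

Lemma measurable_simplex_normalize : measurable_fun setT simplex_normalize.
Proof.
apply/measurable_fun_tnthP => i.
rewrite (_ : _ \o _ = fun t => tnth t i / \sum_(l < m) tnth t l); last first.
  by apply/funext => t /=; rewrite tnth_mktuple.
apply: measurable_funM; first exact: measurable_tnth.
apply: measurableT_comp; first exact: measurable_inv.
by apply: measurable_sum => l; exact: measurable_tnth.
Qed.

HB.instance Definition _ :=
  isMeasurableFun.Build _ _ _ _ simplex_normalize measurable_simplex_normalize.

(* The law of (G_i / \sum_l G_l)_i for independent G_i with G_i gamma of shape
   a_i. A common scale of the G_i cancels in the quotient, hence scale 1. The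
   event \sum_l G_l = 0, where the quotient is the junk value 0, is null when
   m > 0 and all the a_i are positive. *)
Definition dirichlet_prob (a : 'I_m -> R) : probability (m.-tuple R) R :=
  distribution (prod_prob (fun i => gamma_prob (a i))) simplex_normalize.

End simplex_normalize.

Section random_elements.
Context d (T : measurableType d) (R : realType) (P : probability T R).

Definition has_law d' (T' : measurableType d') (X : {RV P >-> T'})
    (nu : probability T' R) : Prop :=
  forall A, measurable A -> distribution P X A = nu A.

Definition independent d1 (T1 : measurableType d1) d2 (T2 : measurableType d2)
    (X : {RV P >-> T1}) (Y : {RV P >-> T2}) : Prop :=
  forall A B, measurable A -> measurable B ->
    P ((X @^-1` A) `&` (Y @^-1` B)) = (P (X @^-1` A) * P (Y @^-1` B))%E.

Definition mutually_independent (I : finType) d' (T' : measurableType d')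
    (X : I -> {RV P >-> T'}) : Prop :=
  forall (J : {set I}) (A : I -> set T'),
    (forall i, i \in J -> measurable (A i)) ->
    P (\bigcap_(i in [set` J]) (X i @^-1` A i)) =
    (\prod_(i in J) P (X i @^-1` A i))%E.

Context n d' (T' : measurableType d') (X : 'I_n -> {RV P >-> T'}).

Definition joint (w : T) : n.-tuple T' := [tuple X j w | j < n].

Lemma measurable_joint : measurable_fun setT joint.
Proof.
apply/measurable_fun_tnthP => j.
rewrite (_ : _ \o _ = X j); first exact: measurable_funPT.
by apply/funext => w /=; rewrite tnth_mktuple.
Qed.

HB.instance Definition _ := isMeasurableFun.Build _ _ _ _ joint measurable_joint.

End random_elements.

Arguments has_law {d T R} P {d' T'} X nu.
Arguments independent {d T R} P {d1 T1 d2 T2} X Y.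
Arguments mutually_independent {d T R} P {I d' T'} X.

Section random_combination.
Context d (T : measurableType d) (R : realType) (P : probability T R).
Context (n k : nat) (W : {RV P >-> n.-tuple R})
  (X : 'I_n -> {RV P >-> k.-tuple R}).

Definition random_combination (w : T) : k.-tuple R :=
  [tuple \sum_(j < n) tnth (W w) j * tnth (X j w) i | i < k].

Lemma measurable_random_combination : measurable_fun setT random_combination.
Proof.
apply/measurable_fun_tnthP => i.
rewrite (_ : _ \o _ = fun w => \sum_(j < n) tnth (W w) j * tnth (X j w) i);
  last by apply/funext => w /=; rewrite tnth_mktuple.
apply: measurable_sum => j; apply: measurable_funM.
- by apply: (measurableT_comp (measurable_tnth j)).
- by apply: (measurableT_comp (measurable_tnth i)).
Qed.

HB.instance Definition _ := isMeasurableFun.Build _ _ _ _ random_combination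
  measurable_random_combination.

End random_combination.

(* Main.v *)
From HB Require Import structures.
Require Import Defs.
From mathcomp Require Import all_boot all_order all_algebra.
From mathcomp Require Import all_classical all_reals all_analysis.
From mathcomp Require Import measurable_realfun ring.

(* Let G be an n x k array of independent variables, G_ji being gamma of shape
   alpha_ji. For each row j, the sum S_j is gamma distributed, the normalized
   row G_j / S_j has the law of X_j, and the two are independent; hence the
   normalized vector S / \sum_j S_j and the normalized rows have jointly the law
   of (W, X_1, ..., X_n). Recombining them as in Z gives the normalized vector
   of column sums of G, and the column sums are independent gamma variables.

   The independence of the sum S and of the normalization N(G) of a gamma vector
   G of shape a is obtained from scaling, without a change of variables in
   several dimensions: the law of c G has density c^-|a| exp ((1 - 1/c) S) with
   respect to the law of G, where |a| = \sum_i a_i, so that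
   E [exp S; S < c, N(G) \in A] = c^|a| E [exp S; S < 1, N(G) \in A].
   Thus, up to a constant factor depending on A, the law of S on the event
   N(G) \in A is the gamma law of shape |a|. *)

Set Implicit Arguments.
Unset Strict Implicit.
Unset Printing Implicit Defensive.

Import Order.TTheory GRing.Theory Num.Theory.
Import HBNNSimple.

Local Open Scope classical_set_scope.
Local Open Scope ring_scope.

(** * Integration against a density and scaling of Lebesgue measure *)

Lemma measurable_preimage d (T : measurableType d) d' (T' : measurableType d')
    (f : T -> T') (A : set T') :
  measurable_fun setT f -> measurable A -> measurable (f @^-1` A).
Proof. by move=> mf mA; rewrite -[X in measurable X]setTI; exact: mf. Qed.

Section density.
Local Open Scope ereal_scope.
Context d (T : measurableType d) (R : realType).
Variables (mu nu : {measure set T -> \bar R}) (g : T -> R).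
Hypotheses (mg : measurable_fun setT g) (g0 : forall x, (0 <= g x)%R).
Hypothesis nuE : forall A, measurable A -> nu A = \int[mu]_(x in A) (g x)%:E.

(** By linearity only the indicators of the level sets of [h] matter, and for them the identity is
    [nuE]. The next lemma passes to monotone limits. *)
Let density_nnsfun (h : {nnsfun T >-> R}) :
  \int[nu]_x (h x)%:E = \int[mu]_x ((h x)%:E * (g x)%:E).
Proof.
have mgE : measurable_fun setT (EFin \o g) by exact/measurable_EFinP.
under eq_integral do rewrite fimfunE -fsumEFin//.
rewrite ge0_integral_fsum//; last 2 first.
- by move=> r; exact/measurable_EFinP/measurable_funM.
- by move=> r x _; rewrite EFinM nnfun_muleindic_ge0.
transitivity (\int[mu]_x (\sum_(r \in range h)
    ((r * \1_(h @^-1` [set r]) x)%:E * (g x)%:E))); last first.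
  apply: eq_integral => x _; rewrite -ge0_mule_fsuml => [|r]; last first.
    by rewrite EFinM nnfun_muleindic_ge0.
  by rewrite fsumEFin// -fimfunE.
rewrite ge0_integral_fsum//; last 2 first.
- move=> r; apply: emeasurable_funM => //.
  exact/measurable_EFinP/measurable_funM.
- move=> r x _; rewrite mule_ge0 ?lee_fin// -lee_fin EFinM.
  exact: nnfun_muleindic_ge0.
apply: eq_fsbigr => r /[!inE] -[t _ <-].
under eq_integral do rewrite EFinM.
under [RHS]eq_integral do rewrite EFinM -muleA.
rewrite !ge0_integralZl ?lee_fin//; last 3 first.
- by apply: emeasurable_funM => //; exact/measurable_EFinP.
- by move=> x _; rewrite mule_ge0 ?lee_fin.
- exact/measurable_EFinP.
congr (_ * _); rewrite integral_indic// setIT nuE// integral_mkcond.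
apply: eq_integral => x _; rewrite patchE indicE.
by case: ifPn; rewrite (mul0e, mul1e).
Qed.

Lemma ge0_integral_density (f : T -> \bar R) :
  measurable_fun setT f -> (forall x, 0 <= f x) ->
  \int[nu]_x f x = \int[mu]_x (f x * (g x)%:E).
Proof.
move=> mf f0; pose h := nnsfun_approx measurableT mf.
have fE x : f x = lim (EFin (h n x) @[n --> \oo]).
  by apply/esym/cvg_lim => //; exact: cvg_nnsfun_approx.
transitivity (lim (\int[nu]_x (h n x)%:E @[n --> \oo])).
  under eq_integral do rewrite fE.
  apply: monotone_convergence => //.
  - by move=> n; exact/measurable_EFinP.
  - by move=> n x _; rewrite lee_fin.
  - by move=> x _ a b ab; rewrite lee_fin; exact/lefP/nd_nnsfun_approx.
under eq_fun do rewrite density_nnsfun.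
have fg x : f x * (g x)%:E = lim ((h n x)%:E * (g x)%:E @[n --> \oo]).
  by apply/esym/cvg_lim => //; apply: cvgeZr => //; exact: cvg_nnsfun_approx.
under [RHS]eq_integral do rewrite fg.
apply/esym; apply: monotone_convergence => //.
- by move=> n; apply: emeasurable_funM; exact/measurable_EFinP.
- by move=> n x _; rewrite mule_ge0 ?lee_fin.
- move=> x _ a b ab; rewrite lee_wpmul2r ?lee_fin//.
  exact/lefP/nd_nnsfun_approx.
Qed.

End density.

(** The image of Lebesgue measure under multiplication by c, multiplied by c, gives []a, b]] the
    mass b - a, and this determines a measure. *)
Lemma lebesgue_measure_scale (R : realType) (c : R) (A : set R) :
  0 < c -> measurable A ->
  (lebesgue_measure A =
   c%:E * lebesgue_measure ((fun x => (c * x)%R) @^-1` A))%E.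
Proof.
move=> c0 mA; have c0' : 0 <= c by exact: ltW.
pose f (x : R) : measurableTypeR R := c * x.
have mc : measurable_fun setT f by exact: measurable_funM.
rewrite (_ : c = (NngNum c0')%:num)//.
apply: (@lebesgue_measure_unique R (mscale (NngNum c0')
    (pushforward (@lebesgue_measure R) f))) => //= _ [[a b]] _ <- /=.
rewrite /mscale/= /pushforward.
rewrite (_ : _ @^-1` _ = `]a / c, b / c]%classic); last first.
  apply/seteqP; split=> x /=; rewrite !in_itv/= ltr_pdivrMr// ler_pdivlMr//;
  by rewrite mulrC.
rewrite !lebesgue_measure_itv/= !lte_fin ltr_pM2r ?invr_gt0//.
case: ifPn => _; last by rewrite mule0.
by rewrite -!EFinB -EFinM; congr EFin; field; rewrite gt_eqF.
Qed.

Lemma ge0_integral_scale (R : realType) (c : R) (f : R -> \bar R) :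
  0 < c -> measurable_fun setT f -> (forall x, 0 <= f x)%E ->
  (\int[lebesgue_measure]_x f x =
   c%:E * \int[lebesgue_measure]_x f (c * x)%R)%E.
Proof.
move=> c0 mf f0; have c0' : 0 <= c by exact: ltW.
pose h (x : measurableTypeR R) : measurableTypeR R := c * x.
have mh : measurable_fun setT h by exact: measurable_funM.
have := ge0_integral_pushforward mh lebesgue_measure measurableT mf
  (fun x _ => f0 x).
rewrite preimage_setT /comp/= => <-.
rewrite (_ : c%:E = (NngNum c0')%:num%:E)// -ge0_integral_mscale//.
apply: eq_measure_integral => /= A mA _.
exact: lebesgue_measure_scale.
Qed.

(** * Scaling of gamma laws and of their products *)

Lemma integral_gamma_prob (R : realType) (a : R) (f : R -> \bar R) :
  0 < a -> measurable_fun setT f -> (forall x, 0 <= f x)%E ->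
  (\int[gamma_prob a]_x f x =
   \int[lebesgue_measure]_x (f x * (gamma_pdf a x)%:E))%E.
Proof.
(* The identity [i] transports Lebesgue measure from [measurableTypeR R] to [R], where
   [gamma_prob a] lives; integrals do not change. *)
move=> a0 mf f0; pose i (x : measurableTypeR R) : R := x.
have mi : measurable_fun setT i by exact: measurable_id.
pose pf : {measure set R -> \bar R} := pushforward lebesgue_measure i.
pose mu := pf mi.
have muE (g : R -> \bar R) (A : set R) : measurable A -> measurable_fun A g ->
    (forall x, 0 <= g x)%E ->
    (\int[mu]_(x in A) g x = \int[lebesgue_measure]_(x in A) g x)%E.
  by move=> mA mg g0; rewrite ge0_integral_pushforward//.
have mp : measurable_fun setT (fun x => (gamma_pdf a x)%:E).
  by apply/measurable_EFinP; exact: measurable_gamma_pdf.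
have p0 x : 0 <= gamma_pdf a x by exact: gamma_pdf_ge0.
rewrite (@ge0_integral_density _ _ R mu (gamma_prob a) (gamma_pdf a))//.
- rewrite muE//; first exact: emeasurable_funM.
  by move=> x; rewrite mule_ge0 ?lee_fin.
- exact: measurable_gamma_pdf.
- move=> A mA; rewrite muE//= ?/gamma_prob ?a0//; exact: measurable_funTS.
Qed.

(* Density, with respect to the gamma law of shape a, of the law of c * G for
   G gamma of shape a. *)
Definition gamma_tilt {R : realType} (c a s : R) : R :=
  c `^ (- a) * expR ((1 - c^-1) * s).

Lemma gamma_tilt_ge0 (R : realType) (c a s : R) : 0 <= gamma_tilt c a s.
Proof. by rewrite mulr_ge0 ?powR_ge0 ?expR_ge0. Qed.

Lemma measurable_gamma_tilt (R : realType) (c a : R) :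
  measurable_fun setT (gamma_tilt c a).
Proof. by apply: measurable_funM => //; exact: measurableT_comp. Qed.

(** Because of this product rule, the density that scaling produces on a product of gamma laws
    depends on the tuple only through its sum. *)
Lemma gamma_tiltD (R : realType) (c a b s t : R) : 0 < c ->
  gamma_tilt c (a + b) (s + t) = gamma_tilt c a s * gamma_tilt c b t.
Proof.
move=> c0; rewrite /gamma_tilt opprD powRD; last by rewrite (gt_eqF c0) implybT.
by rewrite mulrDr expRD mulrACA.
Qed.

Lemma gamma_prob_scale (R : realType) (a c : R) (f : R -> \bar R) :
  0 < a -> 0 < c -> measurable_fun setT f -> (forall x, 0 <= f x)%E ->
  (\int[gamma_prob a]_x f (c * x)%R =
   \int[gamma_prob a]_x (f x * (gamma_tilt c a x)%:E))%E.
Proof.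
move=> a0 c0 mf f0.
have mt : measurable_fun setT (fun x => f x * (gamma_tilt c a x)%:E)%E.
  apply: emeasurable_funM => //; apply/measurable_EFinP.
  exact: measurable_gamma_tilt.
have t0 x : (0 <= f x * (gamma_tilt c a x)%:E)%E.
  by rewrite mule_ge0// lee_fin gamma_tilt_ge0.
have mp : measurable_fun setT (fun x => (gamma_pdf a x)%:E).
  by apply/measurable_EFinP; exact: measurable_gamma_pdf.
have mcf : measurable_fun setT (fun x => f (c * x)%R).
  by apply: measurableT_comp => //; exact: measurable_funM.
rewrite !integral_gamma_prob// [RHS](ge0_integral_scale c0); last 2 first.
- exact: emeasurable_funM.
- by move=> x; rewrite mule_ge0// lee_fin gamma_pdf_ge0.
rewrite -ge0_integralZl ?lee_fin ?ltW//; last 2 first.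
- have := emeasurable_funM mt mp.
  by move=> /measurableT_comp; apply; exact: measurable_funM.
- by move=> x _; rewrite mule_ge0// lee_fin gamma_pdf_ge0.
apply: eq_integral => x _.
rewrite -muleA [RHS]muleCA -!EFinM; congr (_ * _%:E)%E.
rewrite /gamma_pdf !patchE !mem_setE !in_itv/= !andbT.
rewrite pmulr_rgt0//; case: ifPn => x0; last by rewrite !mulr0.
rewrite /gamma_kernel /gamma_tilt powRM ?(ltW c0) ?(ltW x0)//.
(* After the substitution it remains to compare kernels at x and c x: the exponential of the tilt
   repairs exp (-x), and the Jacobian c, the c^-a of the tilt and the c^(a-1) of the kernel multiply
   to 1. *)
have -> : expR (- x) = expR ((1 - c^-1) * (c * x)) * expR (- (c * x)).
  by rewrite -expRD; congr expR; field; rewrite gt_eqF.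
have cE : c * (c `^ (- a) * c `^ (a - 1)) = 1.
  rewrite -powRD; last by rewrite (gt_eqF c0) implybT.
  by rewrite addrA addNr add0r powR_inv1 ?(ltW c0)// divff ?gt_eqF.
by rewrite -[LHS]mul1r -[X in X * _ = _]cE; ring.
Qed.

Section prod_prob_integral.
Local Open Scope ereal_scope.
Context d (T : measurableType d) (R : realType) (n : nat).
Variable mu : 'I_n.+1 -> probability T R.

Lemma ge0_integral_prod_prob (f : n.+1.-tuple T -> \bar R) :
  measurable_fun setT f -> (forall x, 0 <= f x) ->
  \int[prod_prob mu]_t f t =
  \int[mu ord0]_x \int[prod_prob (fun i => mu (lift ord0 i))]_t
    f (tuple_cons (x, t)).
Proof.
move=> mf f0; rewrite ge0_integral_distribution// fubini_tonelli1//; last first.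
  by move=> x; exact: f0.
by apply: measurableT_comp => //; exact: measurable_tuple_cons.
Qed.

End prod_prob_integral.

Section gamma_prod.
Context {R : realType}.

Definition tuple_sum n (t : n.-tuple R) : R := \sum_(i < n) tnth t i.

Lemma measurable_tuple_sum n : measurable_fun setT (@tuple_sum n).
Proof. by apply: measurable_sum => i; exact: measurable_tnth. Qed.

Lemma tuple_sum_cons n (x : R) (t : n.-tuple R) :
  tuple_sum (tuple_cons (x, t)) = x + tuple_sum t.
Proof.
rewrite /tuple_sum big_ord_recl tnth0; congr (_ + _).
by apply: eq_bigr => i _; rewrite tnthS.
Qed.

Lemma measurable_tuple_scale n (c : R) :
  measurable_fun setT (fun t : n.-tuple R => map_tuple ( *%R c) t).
Proof.
apply/measurable_fun_tnthP => i.
rewrite (_ : _ \o _ = fun t => c * tnth t i); last first.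
  by apply/funext => t /=; rewrite tnth_map.
by apply: measurable_funM => //; exact: measurable_tnth.
Qed.

Lemma gamma_prod_scale n (a : 'I_n -> R) (c : R) (f : n.-tuple R -> \bar R) :
  (forall i, 0 < a i) -> 0 < c -> measurable_fun setT f ->
  (forall x, 0 <= f x)%E ->
  (\int[prod_prob (fun i => gamma_prob (a i))]_t f (map_tuple ( *%R c) t) =
   \int[prod_prob (fun i => gamma_prob (a i))]_t
     (f t * (gamma_tilt c (\sum_i a i) (tuple_sum t))%:E))%E.
Proof.
move=> + c0; elim: n a f => [|n IH] a f a0 mf f0.
  apply: eq_integral => t _.
  rewrite (tuple0 t) /tuple_sum /gamma_tilt !big_ord0.
  by rewrite oppr0 powRr0 mulr0 expR0 mulr1 mule1; congr f; apply: val_inj.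
have mtilt m b : measurable_fun setT
    (fun t : m.-tuple R => (gamma_tilt c b (tuple_sum t))%:E).
  apply/measurable_EFinP/measurableT_comp; first exact: measurable_gamma_tilt.
  exact: measurable_tuple_sum.
have mfc x : measurable_fun setT (fun t => f (tuple_cons (x, t))).
  by apply: measurableT_comp => //; exact: measurableT_comp.
rewrite !ge0_integral_prod_prob//; last 3 first.
- by apply: emeasurable_funM => //; exact: mtilt.
- by move=> t; rewrite mule_ge0// lee_fin gamma_tilt_ge0.
- by apply: measurableT_comp => //; exact: measurable_tuple_scale.
(* [F] has the tail already tilted. By induction F (c x) is the inner integral of the left-hand
   side, so only the head remains to be scaled, in dimension one. *)
pose F y := (\int[prod_prob (fun i => gamma_prob (a (lift ord0 i)))]_t
  (f (tuple_cons (y, t)) *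
   (gamma_tilt c (\sum_i a (lift ord0 i)) (tuple_sum t))%:E))%E.
transitivity (\int[gamma_prob (a ord0)]_x F (c * x)%R)%E.
  apply: eq_integral => x _; rewrite /F -IH//.
  apply: eq_integral => t _; congr f.
  by apply: val_inj.
rewrite gamma_prob_scale//; last 2 first.
- apply: (@measurable_fun_fubini_tonelli_F _ _ _ _ _ _ (fun p =>
    f (tuple_cons p) *
    (gamma_tilt c (\sum_i a (lift ord0 i)) (tuple_sum p.2))%:E)%E).
    apply: emeasurable_funM.
      by apply: measurableT_comp => //; exact: measurable_tuple_cons.
    by apply: (measurableT_comp (mtilt _ _)).
  by move=> p; rewrite mule_ge0// lee_fin gamma_tilt_ge0.
- move=> x; apply: integral_ge0 => t _.
  by rewrite mule_ge0// lee_fin gamma_tilt_ge0.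
apply: eq_integral => x _.
rewrite /F -ge0_integralZr ?lee_fin ?gamma_tilt_ge0//; last 2 first.
- by apply: emeasurable_funM => //; exact: mtilt.
- by move=> t _; rewrite mule_ge0// lee_fin gamma_tilt_ge0.
apply: eq_integral => t _; rewrite big_ord_recl tuple_sum_cons gamma_tiltD//.
by rewrite -muleA EFinM; congr (_ * _)%E; rewrite muleC.
Qed.

End gamma_prod.

(** * Measures on the line determined by their behaviour under scaling *)

Section tilted_measures.
Context {R : realType}.
Local Open Scope ereal_scope.

Lemma density_measure d (T : measurableType d)
    (mu : {measure set T -> \bar R}) (g : T -> R) :
  measurable_fun setT g -> (forall x, (0 <= g x)%R) ->
  exists nu : {measure set T -> \bar R},
    forall A, nu A = \int[mu]_(x in A) (g x)%:E.
Proof.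
move=> mg g0; pose nu A := \int[mu]_(x in A) (g x)%:E.
have nu0 : nu set0 = 0 by rewrite /nu integral_set0.
have nu_ge0 A : 0 <= nu A by apply: integral_ge0 => x _; rewrite lee_fin.
have nu_sigma : semi_sigma_additive nu.
  apply: semi_sigma_additive_nng_induced => [|x]; last by rewrite lee_fin.
  exact/measurable_EFinP.
pose M : {measure set T -> \bar R} :=
  HB.pack nu (isMeasure.Build d T R nu nu0 nu_ge0 nu_sigma).
by exists M.
Qed.

(** The weight e^x absorbs the exponential of [gamma_tilt], so that scaling acts on these masses by
    a power of c alone. It is bounded on left half-lines, hence the masses are finite when m is. *)
Definition exp_mass (m : set R -> \bar R) (c : R) : \bar R :=
  \int[m]_(x in `]-oo, c[) (expR x)%:E.

Let mexp (D : set R) : measurable_fun D (fun x : R => (expR x)%:E).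
Proof. by apply/measurable_EFinP/measurable_funTS; exact: measurable_expR. Qed.

Lemma exp_mass_ge0 (m : {measure set R -> \bar R}) c : 0 <= exp_mass m c.
Proof. by apply: integral_ge0 => x _; rewrite lee_fin expR_ge0. Qed.

Lemma exp_mass_fin_num (m : {finite_measure set R -> \bar R}) c :
  exp_mass m c \is a fin_num.
Proof.
rewrite ge0_fin_numE ?exp_mass_ge0//.
apply: (@le_lt_trans _ _ (\int[m]_(x in `]-oo, c[) (expR c)%:E)).
  apply: ge0_le_integral => //.
  by move=> x; rewrite /= in_itv/= lee_fin ler_expR => /ltW.
rewrite integral_cst//= lte_mul_pinfty ?lee_fin ?expR_ge0//.
by rewrite ltey_eq fin_num_measure.
Qed.

(** The half-lines []-oo, c[] are stable under intersection and generate the Borel sets, so the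
    measures e^x m1 and e^x m2 coincide; the density e^-x then gives back m1 and m2. *)
Lemma exp_mass_inj (m1 m2 : {finite_measure set R -> \bar R}) :
  exp_mass m1 =1 exp_mass m2 ->
  forall A, measurable A -> m1 A = m2 A.
Proof.
move=> m12.
have [M1 M1E] := density_measure m1 (@measurable_expR R) (@expR_ge0 R).
have [M2 M2E] := density_measure m2 (@measurable_expR R) (@expR_ge0 R).
have M12 A : measurable A -> M1 A = M2 A.
  apply: (measure_unique (@RGenInftyO.G R) (fun n => `]-oo, n%:R[%classic)).
  - exact: RGenInftyO.measurableE.
  - move=> _ _ [x ->] [y ->]; exists (Num.min x y).
    by apply/seteqP; split=> z /=; rewrite !in_itv/= lt_min => /andP.
  - by move=> n; exists n%:R.
  - apply/seteqP; split=> // x _; exists (Num.bound `|x|)%R => //=.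
    by rewrite in_itv/= (le_lt_trans (ler_norm x))// archi_boundP//.
  - by move=> _ [c ->]; rewrite M1E M2E; exact: m12.
  - by move=> n; rewrite M1E -ge0_fin_numE ?exp_mass_fin_num ?exp_mass_ge0.
have mV : measurable_fun setT (fun x : R => expR (- x)).
  exact: measurableT_comp.
have mE (m M : {measure set R -> \bar R}) A : measurable A ->
    (forall A, M A = \int[m]_(x in A) (expR x)%:E) ->
    m A = \int[M]_(x in A) (expR (- x))%:E.
  move=> mA ME; rewrite integral_mkcond.
  rewrite (@ge0_integral_density _ _ _ m M expR)//.
  - transitivity (\int[m]_x (\1_A x)%:E).
      by rewrite integral_indic// setIT.
    apply: eq_integral => x _; rewrite patchE indicE.
    case: ifPn; rewrite ?mul0e// => _.
    by rewrite -EFinM -expRD addNr expR0.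
  - apply/(measurable_restrictT _ mA); apply/measurable_EFinP.
    exact: measurable_funTS.
  - by apply: erestrict_ge0 => x _; rewrite lee_fin expR_ge0.
move=> A mA; rewrite (mE _ _ _ mA M1E) (mE _ _ _ mA M2E).
by apply: eq_measure_integral => B mB _; exact: M12.
Qed.

(** Integral form of the statement that, for every c > 0, the image of m under multiplication by c
    has density [gamma_tilt c a] with respect to m. *)
Definition scale_tilted (a : R) (m : set R -> \bar R) : Prop :=
  forall c (f : R -> \bar R), (0 < c)%R -> measurable_fun setT f ->
    (forall x, 0 <= f x) ->
    \int[m]_x f (c * x)%R = \int[m]_x (f x * (gamma_tilt c a x)%:E).

Lemma exp_mass_scale (a c : R) (m : {measure set R -> \bar R}) :
  scale_tilted a m -> (0 < c)%R ->
  exp_mass m c = (c `^ a)%:E * exp_mass m 1.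
Proof.
move=> mt c0.
(* Chosen so that f (c x) is e^x on x < 1, while f y times the tilt is c^-a e^y on y < c, since y /
   c + (1 - 1 / c) y = y. *)
pose f (y : R) := (expR (c^-1 * y) * \1_(`]-oo, c[%classic : set R) y)%:E.
have mf : measurable_fun setT f.
  apply/measurable_EFinP/measurable_funM => //.
  by apply: measurableT_comp => //; exact: measurable_funM.
have f0 x : 0 <= f x by rewrite lee_fin mulr_ge0 ?expR_ge0.
have := mt c f c0 mf f0.
rewrite [LHS](_ : _ = exp_mass m 1); last first.
  rewrite /exp_mass [RHS]integral_mkcond; apply: eq_integral => x _.
  rewrite patchE /f indicE mulrA mulVf ?gt_eqF// mul1r !mem_setE !in_itv/=.
  rewrite -[X in (_ < X)%R]mulr1 ltr_pM2l//.
  by case: ifPn; rewrite ?(mulr1, mulr0).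
move=> ->.
rewrite -ge0_integralZl ?lee_fin ?powR_ge0//; last 2 first.
- apply: emeasurable_funM => //.
  by apply/measurable_EFinP; exact: measurable_gamma_tilt.
- by move=> x _; rewrite mule_ge0// lee_fin gamma_tilt_ge0.
rewrite /exp_mass [LHS]integral_mkcond; apply: eq_integral => x _.
rewrite patchE /f indicE mem_setE -!EFinM.
case: ifPn => _; last by rewrite mulr0 mul0r mulr0.
congr EFin; rewrite mulr1 mulrCA /gamma_tilt powRN mulVKf; last first.
  by rewrite gt_eqF ?powR_gt0.
rewrite -expRD; congr expR; field; rewrite gt_eqF//.
Qed.

(* The masses of ]-oo, c[ under e^x m and e^x p are both proportional to c^a. *)
Lemma scale_tilted_unique (a : R) (m : {finite_measure set R -> \bar R})
    (p : probability R R) :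
  scale_tilted a m -> scale_tilted a p ->
  m `]-oo, 0%R]%classic = 0 -> p `]-oo, 0%R]%classic = 0 ->
  forall A, measurable A -> m A = m setT * p A.
Proof.
move=> mt pt m0 p0.
have e0 (q : {measure set R -> \bar R}) c :
    q `]-oo, 0%R]%classic = 0 -> (c <= 0)%R -> exp_mass q c = 0.
  move=> q0 c0; apply: null_set_integral => //.
  apply: (subset_measure0 _ _ _ q0) => // x /=.
  by rewrite !in_itv/= => /ltW /le_trans; exact.
have [r rE] : exists r : {nonneg R}, exp_mass m 1 = r%:num%:E.
  have r0 : (0 <= fine (exp_mass m 1))%R by rewrite fine_ge0 ?exp_mass_ge0.
  by exists (NngNum r0); rewrite /= fineK ?exp_mass_fin_num.
have [s sE] : exists s : {nonneg R}, exp_mass p 1 = s%:num%:E.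
  have s0 : (0 <= fine (exp_mass p 1))%R by rewrite fine_ge0 ?exp_mass_ge0.
  by exists (NngNum s0); rewrite /= fineK ?exp_mass_fin_num.
have scaleE (q : {measure set R -> \bar R}) (u : {nonneg R}) c :
    exp_mass (mscale u q) c = u%:num%:E * exp_mass q c.
  by rewrite /exp_mass ge0_integral_mscale// => x _; rewrite lee_fin expR_ge0.
(* If [s] were 0, all the masses [exp_mass p c] would vanish, so p would be the zero measure,
   against p setT = 1. *)
have s0 : s%:num != 0%R.
  apply/negP => /eqP s0.
  have /(_ setT measurableT) : forall A, measurable A -> p A = mscale s p A.
    apply: exp_mass_inj => c; rewrite scaleE s0 mul0e.
    have [c0|c0] := leP c 0%R; first by rewrite e0.
    by rewrite (exp_mass_scale pt c0) sE s0 mule0.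
  by rewrite /= /mscale s0 mul0e probability_setT => /eqP; rewrite onee_eq0.
(* Cross-multiplying by the masses at c = 1 makes the two measures comparable: for c > 0 both masses
   are r s c^a, for c <= 0 both are 0. *)
have mp A : measurable A -> mscale s m A = mscale r p A.
  apply: exp_mass_inj => c; rewrite !scaleE.
  have [c0|c0] := leP c 0%R; first by rewrite !e0 ?mule0.
  rewrite (exp_mass_scale pt c0) (exp_mass_scale mt c0) rE sE -!EFinM.
  by rewrite mulrCA [in RHS]mulrCA (mulrC s%:num).
(* The case A = setT of [mp] identifies the ratio r / s as the total mass of m. *)
have rsE : s%:num%:E * m setT = r%:num%:E.
  rewrite -[RHS]mule1 -(@probability_setT _ _ _ p); exact: mp.
move=> A mA; have := mp A mA; rewrite /mscale -rsE.
rewrite -muleA => /(congr1 (fun x => s%:num^-1%:E * x)).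
by rewrite !muleA -EFinM mulVf// !mul1e.
Qed.

End tilted_measures.

(** * Independence of the sum and the normalization of a gamma vector *)

(** Packages the law of f on the event D as a finite measure. A factorization of P (f \in B, D) for
    all B thereby becomes an equality of measures, open to the uniqueness lemmas. *)
Lemma restr_pushforward d d' (T : measurableType d) (T' : measurableType d')
    (R : realType) (P : {finite_measure set T -> \bar R}) (D : set T)
    (f : T -> T') : measurable D -> measurable_fun setT f ->
  exists m : {finite_measure set T' -> \bar R},
    (forall B, m B = P (f @^-1` B `&` D)) /\
    (forall h, measurable_fun setT h -> (forall y, (0 <= h y)%E) ->
      (\int[m]_y h y = \int[P]_(x in D) h (f x))%E).
Proof.
move=> mD mf.
pose pm : {measure set T' -> \bar R} := pushforward (mrestr P mD) f.
pose m := pm mf.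
have mE B : m B = P (f @^-1` B `&` D) by [].
have mfin : fin_num_fun m.
  move=> B mB; rewrite mE fin_num_measure//; apply: measurableI => //.
  by apply: measurable_preimage; [exact: mf|].
pose M : {finite_measure set T' -> \bar R} :=
  HB.pack (Measure.sort m) (Measure.class m)
    (Measure_isFinite.Build _ _ _ m mfin).
exists M; split => [//|h mh h0].
transitivity (\int[mrestr P mD]_x h (f x))%E.
  have := ge0_integral_pushforward mf (mrestr P mD) measurableT mh
    (fun x _ => h0 x).
  by rewrite preimage_setT.
rewrite (@ge0_integral_density _ _ _ P (mrestr P mD) \1_D)//; last 2 first.
- by move=> A mA; rewrite integral_indic// setIC.
- exact: measurableT_comp.
rewrite [RHS]integral_mkcond; apply: eq_integral => x _.
by rewrite patchE indicE; case: ifPn; rewrite ?mule1 ?mule0.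
Qed.

Lemma measurable_box d (T : measurableType d) n (A : 'I_n -> set T) :
  (forall i, measurable (A i)) ->
  measurable [set t : n.-tuple T | forall i, A i (tnth t i)].
Proof.
move=> mA; rewrite (_ : mkset _ = \bigcap_(i in [set: 'I_n])
    ((fun t => tnth t i) @^-1` A i)); last first.
  by apply/seteqP; split=> t At i => [_|]; exact: At.
apply: fin_bigcap_measurable => // i _.
by apply: measurable_preimage; [exact: measurable_tnth i|].
Qed.

Lemma scale_tilted_gamma_prob (R : realType) (a : R) :
  0 < a -> scale_tilted a (gamma_prob a).
Proof. by move=> a0 c f c0 mf f0; exact: gamma_prob_scale. Qed.

Lemma gamma_prob_npos (R : realType) (a : R) :
  0 < a -> gamma_prob a `]-oo, 0]%classic = 0%E.
Proof.
move=> a0; rewrite /gamma_prob a0; apply: integral0_eq => x.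
rewrite /= in_itv/= => x0; rewrite /gamma_pdf patchE mem_setE in_itv/= andbT.
by rewrite ltNge x0.
Qed.

Section gamma_vector.
Context {R : realType} (n : nat) (a : 'I_n -> R).
Hypotheses (n0 : (0 < n)%N) (a0 : forall i, 0 < a i).
Local Notation P := (prod_prob (fun i => gamma_prob (a i))).

Lemma gamma_prod_pos : P [set t | forall i, 0 < tnth t i] = 1%E.
Proof.
rewrite (@prod_prob_box _ _ R n (fun i => gamma_prob (a i))
  (fun _ => [set x | 0 < x]))/=; last first.
  move=> _; rewrite (_ : mkset _ = `]0, +oo[%classic)//.
  by apply/seteqP; split=> x /=; rewrite in_itv/= andbT.
apply: big1 => i _.
rewrite (_ : [set x | 0 < x] = ~` `]-oo, 0]%classic); last first.
  by apply/seteqP; split=> x /=; rewrite in_itv/= ltNge => /negP.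
rewrite probability_setC// -[RHS]sube0; congr (_ - _)%E.
exact: gamma_prob_npos.
Qed.

Lemma gamma_sum_npos : P (@tuple_sum R n @^-1` `]-oo, 0]%classic) = 0%E.
Proof.
have mB : measurable [set t : n.-tuple R | forall i, 0 < tnth t i].
  apply: (measurable_box (A := fun=> [set x : R | 0 < x])) => _.
  rewrite (_ : mkset _ = `]0, +oo[%classic)//.
  by apply/seteqP; split=> x /=; rewrite in_itv/= andbT.
apply: (@subset_measure0 _ _ _ P _ (~` [set t | forall i, 0 < tnth t i])) => //.
- by apply: measurable_preimage; [exact: measurable_tuple_sum|].
- exact: measurableC.
(* Positive coordinates have a positive sum; this needs at least one coordinate, as the empty sum is
   0. *)
- move=> t /=; rewrite in_itv/= leNgt => /negP t0 tpos; apply: t0.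
  rewrite /tuple_sum; case: (n) n0 t tpos => // m _ t tpos.
  rewrite big_ord_recl ltr_pwDl// sumr_ge0// => i _; exact: ltW.
- by rewrite [LHS]probability_setC// gamma_prod_pos subee.
Qed.

(** The law [m] of the sum on the event that the normalization is in A satisfies [scale_tilted], so
    it is a multiple of the gamma law; the factor is its total mass, [dirichlet_prob a A]. *)
Lemma gamma_sum_normalize_indep (A : set (n.-tuple R)) (B : set R) :
  measurable A -> measurable B ->
  P (@tuple_sum R n @^-1` B `&` @simplex_normalize R n @^-1` A) =
  (gamma_prob (\sum_i a i) B * dirichlet_prob a A)%E.
Proof.
move=> mA mB.
have sa0 : 0 < \sum_i a i.
  case: (n) n0 a a0 => // m _ b b0.
  rewrite big_ord_recl ltr_pwDl// sumr_ge0// => i _; exact: ltW.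
have mN : measurable (@simplex_normalize R n @^-1` A).
  by apply: measurable_preimage; [exact: measurable_simplex_normalize|].
have [m [mE mI]] := restr_pushforward P mN (@measurable_tuple_sum R n).
rewrite -mE.
rewrite (@scale_tilted_unique R (\sum_i a i) m (gamma_prob (\sum_i a i)))//.
- by rewrite muleC mE preimage_setT setTI.
- move=> c f c0 mf f0; rewrite !mI//; last 3 first.
  + apply: emeasurable_funM => //.
    by apply/measurable_EFinP; exact: measurable_gamma_tilt.
  + by move=> y; rewrite mule_ge0// lee_fin gamma_tilt_ge0.
  + by apply: measurableT_comp => //; exact: measurable_funM.
  (* The indicator of the event is part of [F]: it is invariant under t -> c t, so scaling the tuple
     acts on [F] only through the sum. *)
  pose F := (fun t => f (tuple_sum t)) \_ (@simplex_normalize R n @^-1` A).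
  rewrite integral_mkcond [RHS]integral_mkcond.
  transitivity (\int[P]_t F (map_tuple ( *%R c) t))%E.
    apply: eq_integral => t _; rewrite /F !patchE.
    have -> : tuple_sum (map_tuple ( *%R c) t) = c * tuple_sum t.
      by rewrite /tuple_sum mulr_sumr; apply: eq_bigr => i _; rewrite tnth_map.
    have NE : simplex_normalize (map_tuple ( *%R c) t) = simplex_normalize t.
      (* This holds for every t: when the sum is 0, both quotients have the default value 0. *)
      apply: eq_from_tnth => i; rewrite !tnth_mktuple tnth_map.
      under eq_bigr do rewrite tnth_map.
      by rewrite -mulr_sumr -mulf_div divff ?gt_eqF// mul1r.
    suff -> : (map_tuple ( *%R c) t \in @simplex_normalize R n @^-1` A) =
        (t \in @simplex_normalize R n @^-1` A) by [].
    by apply/idP/idP; rewrite !inE /= NE.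
  rewrite gamma_prod_scale//.
  - apply: eq_integral => t _; rewrite /F !patchE.
    by case: ifPn => // _; rewrite mul0e.
  - apply/(measurable_restrictT _ mN)/measurable_funTS/measurableT_comp => //.
    exact: measurable_tuple_sum.
  - by apply: erestrict_ge0.
- exact: scale_tilted_gamma_prob.
- rewrite mE; apply: (subset_measure0 _ _ _ gamma_sum_npos) => //.
  + apply: measurableI => //.
    by apply: measurable_preimage; [exact: measurable_tuple_sum|].
  + by apply: measurable_preimage; [exact: measurable_tuple_sum|].
- exact: gamma_prob_npos.
Qed.

End gamma_vector.

(** * Product measures: uniqueness, images and products of pairs *)

(** Boxes are stable under intersection and generate the sigma-algebra of tuples, whose generators,
    the preimages under one coordinate, are boxes with [setT] in all other places. *)
Lemma box_measure_unique d (T : measurableType d) (R : realType) n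
    (m1 m2 : {finite_measure set (n.-tuple T) -> \bar R}) :
  (forall A : 'I_n -> set T, (forall i, measurable (A i)) ->
    m1 [set t | forall i, A i (tnth t i)] =
    m2 [set t | forall i, A i (tnth t i)]) ->
  forall E, measurable E -> m1 E = m2 E.
Proof.
move=> m12.
pose box (A : 'I_n -> set T) := [set t : n.-tuple T | forall i, A i (tnth t i)].
pose G := [set box A | A in [set A | forall i, measurable (A i)]].
have GT : G setT.
  by exists (fun=> setT) => //; apply/seteqP; split.
apply: (measure_unique G (fun=> setT)) => //.
- apply/seteqP; split.
  + apply: smallest_sub; first exact: smallest_sigma_algebra.
    move=> B; rewrite -bigcup_seq => -[i _] [A mA <-].
    apply: sub_sigma_algebra; rewrite setTI.
    exists (fun j => if j == i then A else setT) => [j|].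
      by case: ifPn.
    apply/seteqP; split=> t /=; first by move/(_ i); rewrite eqxx.
    by move=> At j; case: ifPn => // /eqP ->.
  + apply: smallest_sub; first exact: sigma_algebra_measurable.
    by move=> _ [A mA <-]; exact: measurable_box.
- move=> _ _ [A mA <-] [B mB <-]; exists (fun i => A i `&` B i).
    by move=> i; exact: measurableI.
  apply/seteqP; split=> t; first by move=> AB; split=> i; have [] := AB i.
  by move=> [At Bt] i; split; [exact: At|exact: Bt].
- by rewrite bigcup_const//; exists 0%N.
- by move=> _ [A mA <-]; exact: m12.
- by move=> _; rewrite -ge0_fin_numE// fin_num_measure.
Qed.

(** The factor [r] allows [m] to be a law restricted to an event. Taking every [A i] to be [setT]
    shows that [r] is the total mass of [m]. *)
Lemma prod_prob_unique d (T : measurableType d) (R : realType) n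
    (m : {finite_measure set (n.-tuple T) -> \bar R}) (r : \bar R)
    (mu : 'I_n -> probability T R) :
  (forall A : 'I_n -> set T, (forall i, measurable (A i)) ->
    m [set t | forall i, A i (tnth t i)] = (r * \prod_(i < n) mu i (A i))%E) ->
  forall E, measurable E -> m E = (r * prod_prob mu E)%E.
Proof.
move=> mE.
have rE : r = m setT.
  rewrite (_ : setT = [set t | forall i, (fun=> setT) i (tnth t i)]);
    last by apply/seteqP; split.
  rewrite (mE (fun=> setT))// big1 ?mule1// => i _; exact: probability_setT.
have r0 : 0 <= fine r by rewrite fine_ge0// rE.
have {}rE : r = (NngNum r0)%:num%:E by rewrite /= fineK// rE fin_num_measure.
move=> E mE'; transitivity (mscale (NngNum r0) (prod_prob mu) E); last first.
  by congr (_ * _)%E; rewrite {2}rE.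
apply: box_measure_unique => // A mA.
rewrite mE// -prod_prob_box//; congr (_ * _)%E; exact: rE.
Qed.

Section prod_prob_map.
Context d (T : measurableType d) d' (T' : measurableType d') (R : realType).
Context (n : nat) (f : T -> T') (mf : measurable_fun setT f).

Lemma measurable_map_tuple :
  measurable_fun setT (fun t : n.-tuple T => map_tuple f t).
Proof.
apply/measurable_fun_tnthP => i.
rewrite (_ : _ \o _ = f \o (fun t => tnth t i)); last first.
  by apply/funext => t /=; rewrite tnth_map.
by apply: measurableT_comp => //; exact: measurable_tnth.
Qed.

Lemma prod_prob_map (mu : 'I_n -> probability T R)
    (nu : 'I_n -> probability T' R) (E : set (n.-tuple T')) :
  (forall i A, measurable A -> mu i (f @^-1` A) = nu i A) -> measurable E ->
  prod_prob mu ((fun t => map_tuple f t) @^-1` E) = prod_prob nu E.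
Proof.
move=> munu mE.
have [m [mmE _]] :=
  restr_pushforward (prod_prob mu) measurableT measurable_map_tuple.
rewrite -[LHS](congr1 _ (setIT _)) -mmE -[RHS]mul1e.
apply: prod_prob_unique => // A mA.
rewrite mul1e mmE setIT.
transitivity (prod_prob mu [set t | forall i, (f @^-1` A i) (tnth t i)]).
  congr (prod_prob mu _); apply/seteqP.
  by split=> t /= At i; have := At i; rewrite tnth_map.
rewrite (prod_prob_box mu (A := fun i => f @^-1` A i)); last first.
  by move=> i; apply: measurable_preimage; [exact: mf|].
by apply: eq_bigr => i _; exact: munu.
Qed.

End prod_prob_map.

(** Rectangles determine the product measure: independence is checked on them and then used for
    events such as preimages under [combination]. *)
Lemma indep_pair_law d (T : measurableType d) d1 (T1 : measurableType d1)
    d2 (T2 : measurableType d2) (R : realType) (P : probability T R)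
    (nu1 : probability T1 R) (nu2 : probability T2 R) (f : T -> T1)
    (g : T -> T2) :
  measurable_fun setT f -> measurable_fun setT g ->
  (forall A B, measurable A -> measurable B ->
    P (f @^-1` A `&` g @^-1` B) = (nu1 A * nu2 B)%E) ->
  forall E, measurable E -> P [set x | E (f x, g x)] = (nu1 \x nu2)%E E.
Proof.
move=> mf mg fgE E mE.
have [m [mmE _]] := restr_pushforward P measurableT (measurable_fun_pair mf mg).
rewrite (@product_measure_unique _ _ _ _ _ nu1 nu2 m)//.
  by apply/esym; rewrite -[X in _ = P X]setIT; exact: mmE.
move=> A B mA mB; rewrite -fgE// -[X in _ = P X]setIT; exact: mmE.
Qed.

Section prod_prob_unzip.
Local Open Scope ereal_scope.
Context d1 (T1 : measurableType d1) d2 (T2 : measurableType d2) (R : realType).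
Context (n : nat).
Context (mu : 'I_n -> probability T1 R) (nu : 'I_n -> probability T2 R).
Context (q : 'I_n -> probability (T1 * T2)%type R).
Hypothesis qE : forall i A B, measurable A -> measurable B ->
  q i (A `*` B) = mu i A * nu i B.

Local Notation fsts := (fun t : n.-tuple (T1 * T2) => map_tuple fst t).
Local Notation snds := (fun t : n.-tuple (T1 * T2) => map_tuple snd t).

Let mfsts : measurable_fun setT fsts. Proof. exact: measurable_map_tuple. Qed.
Let msnds : measurable_fun setT snds. Proof. exact: measurable_map_tuple. Qed.

Let unzip_box (A : 'I_n -> set T1) (B : 'I_n -> set T2) :
  (forall i, measurable (A i)) -> (forall i, measurable (B i)) ->
  prod_prob q (fsts @^-1` [set t | forall i, A i (tnth t i)] `&`
               snds @^-1` [set t | forall i, B i (tnth t i)]) =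
  (\prod_(i < n) mu i (A i)) * \prod_(i < n) nu i (B i).
Proof.
move=> mA mB.
transitivity (prod_prob q [set t | forall i, (A i `*` B i) (tnth t i)]).
  congr (prod_prob q _); apply/seteqP; split=> t /=.
    by move=> [At Bt] i; have := At i; have := Bt i; rewrite !tnth_map.
  by move=> ABt; split=> i; have := ABt i; rewrite !tnth_map => -[].
rewrite (prod_prob_box q (A := fun i => A i `*` B i)); last first.
  by move=> i; exact: measurableX.
by rewrite -big_split/=; apply: eq_bigr => i _; exact: qE.
Qed.

(** One side at a time: with B fixed, boxes A suffice by uniqueness for the first components; with
    such a box fixed, boxes B suffice for the second ones. This leaves [unzip_box]. *)
Let unzip_rectangle (A : set (n.-tuple T1)) (B : set (n.-tuple T2)) :
  measurable A -> measurable B ->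
  prod_prob q (fsts @^-1` A `&` snds @^-1` B) = prod_prob mu A * prod_prob nu B.
Proof.
have mfst A' : measurable A' -> measurable (fsts @^-1` A').
  by move=> mA'; apply: measurable_preimage; [exact: mfsts|].
have msnd B' : measurable B' -> measurable (snds @^-1` B').
  by move=> mB'; apply: measurable_preimage; [exact: msnds|].
move=> mA mB.
have [m [mE _]] := restr_pushforward (prod_prob q) (msnd _ mB) mfsts.
rewrite -mE muleC; apply: prod_prob_unique => // {mA}A mA.
rewrite mE setIC.
have [m' [m'E _]] := restr_pushforward (prod_prob q)
  (mfst _ (measurable_box mA)) msnds.
rewrite -m'E muleC; apply: prod_prob_unique => // {mB mE}B mB.
by rewrite m'E setIC; exact: unzip_box.
Qed.

Lemma prod_prob_unzip (E : set (n.-tuple T1 * n.-tuple T2)) : measurable E ->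
  prod_prob q [set t | E (map_tuple fst t, map_tuple snd t)] =
  (prod_prob mu \x prod_prob nu) E.
Proof.
exact: (indep_pair_law mfsts msnds unzip_rectangle).
Qed.

End prod_prob_unzip.

(** * Sums of independent gamma variables and column sums of arrays *)

Lemma gamma_sum_law (R : realType) (n : nat) (a : 'I_n -> R) (B : set R) :
  (0 < n)%N -> (forall i, 0 < a i) -> measurable B ->
  prod_prob (fun i => gamma_prob (a i)) (@tuple_sum R n @^-1` B) =
  gamma_prob (\sum_i a i) B.
Proof.
move=> n0 a0 mB; have := gamma_sum_normalize_indep n0 a0 measurableT mB.
rewrite preimage_setT setIT => ->.
by rewrite [X in (_ * X)%E]probability_setT mule1.
Qed.

(** The case b = 0 is included because [gamma_prob 0] is the Dirac mass at 0, neutral for addition;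
    it lets the induction on rows start from the empty array. For b > 0 this is [gamma_sum_law] for
    a vector of two coordinates. *)
Lemma gamma_prob_add (R : realType) (a b : R) (B : set R) :
  0 < a -> 0 <= b -> measurable B ->
  (gamma_prob a \x gamma_prob b)%E [set z | B (z.1 + z.2)] =
  gamma_prob (a + b) B.
Proof.
move=> a0; rewrite le_eqVlt => /predU1P[<-|b0] mB.
  rewrite addr0 /product_measure1 -[X in _ = gamma_prob a X]setIT.
  rewrite -integral_indic//.
  apply: eq_integral => x _ /=.
  rewrite /gamma_prob ltxx diracE indicE; congr (_%:R%:E).
  by congr nat_of_bool; apply/idP/idP; rewrite mem_xsection !inE /= addr0.
pose c (i : 'I_2) := if i == ord0 then a else b.
pose f (z : R * R) := [tuple z.1; z.2].
have mf : measurable_fun setT f.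
  apply/measurable_fun_tnthP => -[[|[|]]] //= i2.
  - by rewrite (_ : _ \o _ = fst)//; apply/funext => -[].
  - by rewrite (_ : _ \o _ = snd)//; apply/funext => -[].
pose gamma r : probability R R := gamma_prob r.
pose P : probability (R * R)%type R := (gamma a \x gamma b)%E.
have [m [mE _]] := restr_pushforward P measurableT mf.
transitivity (m (@tuple_sum R 2 @^-1` B)).
  rewrite mE setIT; congr (product_measure1 _ _ _); apply/seteqP.
  by split=> -[x y]; rewrite /= /tuple_sum !big_ord_recl big_ord0 addr0.
rewrite (@prod_prob_unique _ _ _ _ m 1 (fun i => gamma_prob (c i))).
- have c0 i : 0 < c i by rewrite /c; case: ifP.
  rewrite mul1e (@gamma_sum_law R 2 c B isT c0 mB).
  by rewrite !big_ord_recl big_ord0 addr0.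
- move=> A mA; rewrite mE setIT mul1e !big_ord_recl big_ord0 mule1.
  rewrite -product_measure1E//; congr (product_measure1 _ _ _).
  apply/seteqP; split=> -[x y] /=.
    by move=> Axy; split; [exact: (Axy ord0)|exact: (Axy (lift ord0 ord0))].
  by move=> [Ax Ay] i; case: (unliftP ord0 i) => [j ->|->]//; rewrite (ord1 j).
- by apply: measurable_preimage; [exact: measurable_tuple_sum|].
Qed.

Section column_sums.
Context {R : realType} {k : nat}.

Definition column_sums n (v : n.-tuple (k.-tuple R)) : k.-tuple R :=
  [tuple \sum_(j < n) tnth (tnth v j) i | i < k].

Lemma measurable_column_sums n : measurable_fun setT (@column_sums n).
Proof.
apply/measurable_fun_tnthP => i.
rewrite (_ : _ \o _ = fun v => \sum_(j < n) tnth (tnth v j) i); last first.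
  by apply/funext => v /=; rewrite tnth_mktuple.
apply: measurable_sum => j.
apply: (measurableT_comp (measurable_tnth i)); exact: measurable_tnth.
Qed.

Definition tuple_add (z : k.-tuple R * k.-tuple R) : k.-tuple R :=
  [tuple tnth z.1 i + tnth z.2 i | i < k].

Lemma measurable_tuple_add : measurable_fun setT tuple_add.
Proof.
apply/measurable_fun_tnthP => i.
rewrite (_ : _ \o _ = fun z => tnth z.1 i + tnth z.2 i); last first.
  by apply/funext => z /=; rewrite tnth_mktuple.
by apply: measurable_funD; exact: (measurableT_comp (measurable_tnth i)).
Qed.

Lemma column_sums_cons n (t : k.-tuple R) (v : n.-tuple (k.-tuple R)) :
  column_sums (tuple_cons (t, v)) = tuple_add (t, column_sums v).
Proof.
apply: eq_from_tnth => i; rewrite !tnth_mktuple/= big_ord_recl tnth0.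
by congr (_ + _); apply: eq_bigr => j _; rewrite tnthS.
Qed.

Lemma gamma_prod_add (a b : 'I_k -> R) (E : set (k.-tuple R)) :
  (forall i, 0 < a i) -> (forall i, 0 <= b i) -> measurable E ->
  (prod_prob (fun i => gamma_prob (a i)) \x
   prod_prob (fun i => gamma_prob (b i)))%E (tuple_add @^-1` E) =
  prod_prob (fun i => gamma_prob (a i + b i)) E.
Proof.
move=> a0 b0 mE.
pose gamma c : probability R R := gamma_prob c.
pose q i : probability (R * R)%type R := (gamma (a i) \x gamma (b i))%E.
rewrite -(@prod_prob_unzip _ _ _ _ R k _ _ q)//; last 2 first.
- by move=> i A B mA mB; exact: product_measure1E.
- by apply: measurable_preimage; [exact: measurable_tuple_add|].
pose add (z : R * R) := z.1 + z.2.
rewrite -(@prod_prob_map _ _ _ _ R k add _ q)//.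
- congr (prod_prob q _); apply/seteqP.
  have addE v : tuple_add (map_tuple fst v, map_tuple snd v) = map_tuple add v.
    by apply: eq_from_tnth => i; rewrite tnth_mktuple !tnth_map.
  by split=> v /=; rewrite addE.
- exact: measurable_funD.
- by move=> i A mA; exact: gamma_prob_add.
Qed.

(** Base case of the induction on rows: an empty array has zero column sums, and the Dirac value of
    [gamma_prob] at shape 0 agrees with this. *)
Lemma gamma_prod0 (b : 'I_k -> R) (E : set (k.-tuple R)) :
  (forall i, b i = 0) -> measurable E ->
  \d_(@column_sums 0 [tuple]) E = prod_prob (fun i => gamma_prob (b i)) E.
Proof.
move=> b0 mE; rewrite -[RHS]mul1e; apply: prod_prob_unique => // A mA.
rewrite mul1e /= diracE; have [A0|] := pselect (forall i, A i 0).
  rewrite mem_set; last by move=> i; rewrite tnth_mktuple big_ord0.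
  rewrite big1// => i _.
  by rewrite /= /gamma_prob b0 ltxx diracE mem_set.
move=> /existsNP[i Ai]; rewrite memNset.
  by rewrite (bigD1 i)//= /gamma_prob b0 ltxx diracE memNset// mul0e.
by move=> /(_ i); rewrite tnth_mktuple big_ord0.
Qed.

Lemma column_sums_law n (alpha : 'I_n -> 'I_k -> R) (E : set (k.-tuple R)) :
  (forall j i, 0 < alpha j i) -> measurable E ->
  prod_prob (fun j => prod_prob (fun i => gamma_prob (alpha j i)))
    (@column_sums n @^-1` E) =
  prod_prob (fun i => gamma_prob (\sum_(j < n) alpha j i)) E.
Proof.
elim: n alpha E => [|n IH] alpha E alpha0 mE.
  transitivity (\d_(@column_sums 0 [tuple]) E : \bar R).
    by rewrite /= !diracE; congr (_%:R%:E).
  by apply: gamma_prod0 => // i; rewrite big_ord0.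
pose mu0 := prod_prob (fun i => gamma_prob (alpha ord0 i)).
pose Q := prod_prob (fun j =>
  prod_prob (fun i => gamma_prob (alpha (lift ord0 j) i))).
pose nu := prod_prob (fun i => gamma_prob (\sum_(j < n) alpha (lift ord0 j) i)).
transitivity ((mu0 \x Q)%E [set z | E (tuple_add (z.1, column_sums z.2))]).
  rewrite /= /distribution /pushforward; congr (product_measure1 _ _ _).
  by apply/seteqP; split=> -[t v]; rewrite /= column_sums_cons.
(* The rows after the first enter only through their column sums, which are independent of the first
   row and have law [nu] by induction. *)
rewrite (@indep_pair_law _ _ _ _ _ _ R (mu0 \x Q)%E mu0 nu fst
  (@column_sums n \o snd) _ _ _ (tuple_add @^-1` E))//.
- have b0 i : 0 <= \sum_(j < n) alpha (lift ord0 j) i.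
    by rewrite sumr_ge0// => j _; exact: ltW.
  rewrite (gamma_prod_add (alpha0 ord0) b0 mE).
  by under [in RHS]eq_fun do rewrite big_ord_recl.
- by apply: measurableT_comp => //; exact: measurable_column_sums.
- move=> A B mA mB; rewrite -IH// -product_measure1E//.
  by apply: measurable_preimage; [exact: measurable_column_sums|].
- by apply: measurable_preimage; [exact: measurable_tuple_add|].
Qed.

End column_sums.

(** * Recombination of the normalized rows of a gamma array *)

Lemma eq_on_full_event d (T : measurableType d) (R : realType)
    (P : probability T R) (D A B : set T) :
  measurable D -> measurable A -> measurable B -> P D = 1%E ->
  A `&` D = B `&` D -> P A = P B.
Proof.
move=> mD mA mB PD ABD.
have D0 : P (~` D) = 0%E by rewrite probability_setC// PD subee.
have PE C : measurable C -> P C = P (C `&` D).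
  move=> mC; rewrite [LHS](measureDI P mC mD).
  rewrite [X in (X + _)%E](_ : _ = 0%E) ?add0e//.
  apply: (subset_measure0 _ _ _ D0); [exact: measurableD|exact: measurableC|].
  by move=> x [].
by rewrite (PE A)// ABD -PE.
Qed.

Section sum_normalize.
Context {R : realType} {k : nat}.

Definition sum_normalize (t : k.-tuple R) : R * k.-tuple R :=
  (tuple_sum t, simplex_normalize t).

Lemma measurable_sum_normalize : measurable_fun setT sum_normalize.
Proof.
by apply: measurable_fun_pair;
  [exact: measurable_tuple_sum|exact: measurable_simplex_normalize].
Qed.

HB.instance Definition _ :=
  isMeasurableFun.Build _ _ _ _ sum_normalize measurable_sum_normalize.

Definition combination n (z : n.-tuple R * n.-tuple (k.-tuple R)) :
  k.-tuple R :=
  [tuple \sum_(j < n) tnth z.1 j * tnth (tnth z.2 j) i | i < k].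

Lemma measurable_combination n : measurable_fun setT (@combination n).
Proof.
apply/measurable_fun_tnthP => i.
rewrite (_ : _ \o _ = fun z => \sum_(j < n) tnth z.1 j * tnth (tnth z.2 j) i);
  last by apply/funext => z /=; rewrite tnth_mktuple.
apply: measurable_sum => j; apply: measurable_funM.
  exact: (measurableT_comp (measurable_tnth j)).
apply: (measurableT_comp (measurable_tnth i)).
exact: (measurableT_comp (measurable_tnth j)).
Qed.

(** The row sum cancels in (S_j / S) (G_ji / S_j), which is why it must be nonzero, and the total S
    is the same by rows and by columns. *)
Lemma combination_normalize n (v : n.-tuple (k.-tuple R)) :
  (forall j, 0 < tuple_sum (tnth v j)) ->
  combination (simplex_normalize (map_tuple (@tuple_sum R k) v),
               map_tuple (@simplex_normalize R k) v) =
  simplex_normalize (column_sums v).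
Proof.
move=> v0; apply: eq_from_tnth => i; rewrite !tnth_mktuple/= mulr_suml.
have -> : \sum_(l < k) tnth (column_sums v) l =
    \sum_(j < n) tnth (map_tuple (@tuple_sum R k) v) j.
  under eq_bigr do rewrite tnth_mktuple.
  by rewrite exchange_big/=; apply: eq_bigr => j _; rewrite tnth_map.
apply: eq_bigr => j _; rewrite !(tnth_mktuple, tnth_map) mulrC mulrA divfK//.
by rewrite gt_eqF// v0.
Qed.

End sum_normalize.

(** Both sides become probabilities of events about one gamma array with independent rows of laws
    [mu j]; these events agree wherever all row sums are positive. *)
Lemma array_law (R : realType) (n k : nat) (alpha : 'I_n -> 'I_k -> R)
    (E : set (k.-tuple R)) :
  (0 < k)%N -> (forall j i, 0 < alpha j i) -> measurable E ->
  (dirichlet_prob (fun j => (\sum_(i < k) alpha j i)%R) \x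
   prod_prob (fun j => dirichlet_prob (alpha j)))%E
    (@combination R k n @^-1` E) =
  dirichlet_prob (fun i => \sum_(j < n) alpha j i) E.
Proof.
move=> k0 alpha0 mE.
pose mu j := prod_prob (fun i => gamma_prob (alpha j i)).
pose sigma j : probability R R := gamma_prob (\sum_(i < k) alpha j i).
pose q j : probability (R * k.-tuple R)%type R :=
  distribution (mu j) (@sum_normalize R k).
have mc : measurable (@combination R k n @^-1` E).
  by apply: measurable_preimage; [exact: measurable_combination|].
have mN m (A : set (m.-tuple R)) : measurable A ->
    measurable (@simplex_normalize R m @^-1` A).
  move=> mA; apply: measurable_preimage mA.
  exact: measurable_simplex_normalize.
pose F (z : n.-tuple R * n.-tuple (k.-tuple R)) :=
  combination (simplex_normalize z.1, z.2).
have mF : measurable_fun setT F.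
  apply: measurableT_comp; first exact: measurable_combination.
  apply: measurable_fun_pair => //.
  by apply: measurableT_comp => //; exact: measurable_simplex_normalize.
have mFE : measurable (F @^-1` E).
  by apply: measurable_preimage; [exact: mF|].
pose rho := prod_prob (fun j => dirichlet_prob (alpha j)).
(* The Dirichlet law of the weights is unfolded as the normalization of independent gamma variables
   with laws [sigma j], which play the role of row sums. *)
transitivity ((prod_prob sigma \x rho)%E (F @^-1` E)).
  rewrite -(@indep_pair_law _ _ _ _ _ _ R (prod_prob sigma \x rho)%E
    (dirichlet_prob (fun j => (\sum_(i < k) alpha j i)%R)) rho
    (@simplex_normalize R n \o fst) snd)//.
  - by apply: measurableT_comp => //; exact: measurable_simplex_normalize.
  - move=> A B mA mB.
    exact: (@product_measure1E _ _ _ _ _ (prod_prob sigma) rho _ _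
      (mN _ _ mA) mB).
have qE j A B : measurable A -> measurable B ->
    (q j (A `*` B) = sigma j A * dirichlet_prob (alpha j) B)%E.
  by move=> mA mB; exact: gamma_sum_normalize_indep.
(* By [qE] each sum and its normalized row form an independent pair of law [q j], so the two product
   laws merge into one product over rows; [q j] is then pulled back to the row itself. *)
rewrite -(prod_prob_unzip qE mFE).
have mG : measurable [set t : n.-tuple (R * k.-tuple R) |
    (F @^-1` E) (map_tuple fst t, map_tuple snd t)].
  have mf := @measurable_fst _ _ R (k.-tuple R : measurableType _).
  have ms := @measurable_snd _ _ R (k.-tuple R : measurableType _).
  have := measurableT_comp mF (measurable_fun_pair
    (@measurable_map_tuple _ _ _ _ n _ mf)
    (@measurable_map_tuple _ _ _ _ n _ ms)).
  by move=> /(_ measurableT E mE); rewrite setTI.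
rewrite -(@prod_prob_map _ _ _ _ R n (@sum_normalize R k) _ mu q)//.
rewrite -[RHS](column_sums_law alpha0 (mN _ _ mE)).
pose pos := [set t : k.-tuple R | 0 < tuple_sum t].
have posE : pos = ~` (@tuple_sum R k @^-1` `]-oo, 0]%classic).
  by apply/seteqP; split=> t; rewrite /pos /= in_itv/= ltNge => /negP.
have mpos : measurable pos.
  rewrite posE; apply: measurableC.
  by apply: measurable_preimage; [exact: measurable_tuple_sum|].
(* The two events need only agree on the almost sure event that all row sums are positive, where
   [combination_normalize] applies. *)
apply: (@eq_on_full_event _ _ _ _ [set v | forall j, pos (tnth v j)]).
- exact: (measurable_box (fun=> mpos)).
- exact: (measurable_preimage (@measurable_map_tuple _ _ _ _ n _
    (@measurable_sum_normalize R k)) mG).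
- exact: (measurable_preimage (@measurable_column_sums R k n) (mN _ _ mE)).
- rewrite (prod_prob_box mu (fun=> mpos)); apply: big1 => j _.
  rewrite posE probability_setC; last first.
    by apply: measurable_preimage; [exact: measurable_tuple_sum|].
  by rewrite -[RHS]sube0; congr (_ - _)%E; exact: gamma_sum_npos.
have vE (v : n.-tuple (k.-tuple R)) : (forall j, pos (tnth v j)) ->
    F (map_tuple fst (map_tuple (@sum_normalize R k) v),
       map_tuple snd (map_tuple (@sum_normalize R k) v)) =
    simplex_normalize (column_sums v).
  move=> v0; rewrite -combination_normalize// /F; congr (combination (_, _)).
    by congr simplex_normalize; apply: eq_from_tnth => j; rewrite !tnth_map.
  by apply: eq_from_tnth => j; rewrite !tnth_map.
by apply/seteqP; split=> v [] /= + v0; rewrite vE.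
Qed.

(** * From laws and independence of random vectors to the combination *)

Lemma joint_law d (T : measurableType d) d' (T' : measurableType d')
    (R : realType) (P : probability T R) (n : nat)
    (X : 'I_n -> {RV P >-> T'}) (nu : 'I_n -> probability T' R) :
  mutually_independent P X -> (forall j, has_law P (X j) (nu j)) ->
  has_law P (joint X) (prod_prob nu).
Proof.
move=> Xind Xlaw E mE; rewrite -[RHS]mul1e; apply: prod_prob_unique => // A mA.
(* Mutual independence is used for the full index set, which gives the probability of a box. *)
rewrite mul1e; pose J : {set 'I_n} := finset.finset xpredT.
transitivity (P (\bigcap_(j in [set` J]) (X j @^-1` A j))).
  congr (P _); apply/seteqP; split=> w /=.
    by move=> Aw j _; have := Aw j; rewrite tnth_mktuple.
  by move=> Aw j; rewrite tnth_mktuple; apply: Aw; rewrite /= finset.inE.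
rewrite (Xind J A)//; under eq_bigl do rewrite finset.inE.
by apply: eq_bigr => j _; exact: Xlaw.
Qed.

Theorem theorem2p1 (R : realType) (d : measure_display) (T : measurableType d)
    (P : probability T R) (n k : nat) (n_ge1 : (1 <= n)%N) (k_ge1 : (1 <= k)%N)
    (alpha : 'I_n -> 'I_k -> R) (alpha_gt0 : forall j i, 0 < alpha j i)
    (X : 'I_n -> {RV P >-> k.-tuple R}) (W : {RV P >-> n.-tuple R})
    (X_indep : mutually_independent P X)
    (X_law : forall j, has_law P (X j) (dirichlet_prob (alpha j)))
    (WX_indep : independent P W (joint X))
    (W_law : has_law P W (dirichlet_prob (fun j => \sum_(i < k) alpha j i))) :
  has_law P (random_combination W X)
    (dirichlet_prob (fun i => \sum_(j < n) alpha j i)).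
Proof.
move=> E mE; rewrite -array_law//.
(* The product measure in [array_law] is the law of the pair of [W] and [joint X], and Z is
   [combination] of that pair. *)
rewrite -(@indep_pair_law _ _ _ _ _ _ R P _ _ W (joint X))//.
- congr (P _); apply/seteqP.
  have ZE w : random_combination W X w = combination (W w, joint X w).
    apply: eq_from_tnth => i; rewrite !tnth_mktuple.
    by apply: eq_bigr => j _; rewrite tnth_mktuple.
  by split=> w /=; rewrite ZE.
- move=> A B mA mB; rewrite WX_indep//; congr (_ * _)%E; first exact: W_law.
  exact: (joint_law X_indep X_law).
- by apply: measurable_preimage; [exact: measurable_combination|].
Qed.
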